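(* Let $\mathrm{P}$ be a program in $\textsc{pbp}$, let $n\in\mathbb{N}$, and let $|\psi\rangle\in\mathbb{C}^{2^n}$ be any quantum state on $n$ qubits. Then $\llbracket \mathbf{compile}(\mathrm{P},n)\rrbracket(|\psi\rangle)=\llbracket \mathrm{P}\rrbracket(|\psi\rangle)$.
   Context: The language. Integer expressions: $\mathrm{i}::= \mathrm{x}\mid n\mid \mathrm{i}\pm n\mid |\mathrm{s}|$ ($n$ a constant); Boolean expressions built from comparisons of integers and Boolean connectives; qubit expressions $\mathrm{q}::=\mathrm{s}[\mathrm{i}]$; sorted-set expressions $\mathrm{s}::=\bar{\mathrm{q}}\mid \mathrm{s}\ominus[\mathrm{i}]$. Statements: $\mathrm{S}::=\mathbf{skip};\mid \mathrm{q}\,\texttt{*=}\,\mathrm{U}^f(\mathrm{j});\mid \mathrm{S}\ \mathrm{S}\mid \mathbf{if}\ \mathrm{b}\ \mathbf{then}\ \mathrm{S}\ \mathbf{else}\ \mathrm{S}\mid \mathbf{qcase}\ \mathrm{q}\ \mathbf{of}\ \{0\to \mathrm{S},1\to\mathrm{S}\}\mid \mathbf{call}\ \mathrm{proc}(\mathrm{s});$. A program $\mathrm{P}=\mathrm{D}::\mathrm{S}$ is a list $\mathrm{D}$ of procedure declarations $\mathbf{decl}\ \mathrm{proc}(\bar{\mathrm{q}})\{\mathrm{S}^{\mathrm{proc}}\}$ (one per procedure name) followed by a main statement. Here $\mathrm{U}^f(\mathrm{j})$ denotes a single-qubit unitary from a fixed family (e.g. NOT, Hadamard, $R_Y$, phase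 $\mathrm{Ph}$ with $\llbracket\mathrm{Ph}\rrbracket(f)(k)=\mathrm{diag}(1,e^{if(k)})$), depending on an integer and a polynomial-time approximable total function $f:\mathbb{Z}\to[0,2\pi)$. Semantics. Qubits are pointers (indices) and sorted sets denote lists of distinct qubit indices; $\bar{\mathrm{q}}$ evaluates to the current list $l$ (initially $[1,\dots,n]$), $|\mathrm{s}|$ to its length, $\mathrm{s}[\mathrm{i}]$ to its $\mathrm{i}$-th element, and $\mathrm{s}\ominus[\mathrm{i}]$ to the list with its $\mathrm{i}$-th element removed (the empty list if $\mathrm{i}$ is out of range). A state is $|\psi\rangle\in\mathbb{C}^{2^n}$ together with a set $A$ of accessible qubits (initially all). $\mathrm{q}\,\texttt{*=}\,\mathrm{U}^f(\mathrm{j})$ applies the corresponding $2\times 2$ unitary to qubit $\mathrm{q}$ (error if $\mathrm{q}\notin A$); sequence and classical conditional are standard; $\mathbf{qcase}\ \mathrm{q}\ \mathbf{of}\{0\to\mathrm{S}_0,1\to\mathrm{S}_1\}$ with $\mathrm{q}$ evaluating to $k\in A$ runs each $\mathrm{S}_b$ on $|\psi\rangle$ with $A\setminus\{k\}$ yielding $|\psi_b\rangle$, and results in $\sum_{b}|b\rangle_k\langle b|_k|\psi_b\rangle$ (error if $k\notin A$ or a branch errors); $\mathbf{call}\ \mathrm{proc}(\mathrm{s})$ does nothing if $\mathrm{s}$ evaluates to the empty list, and otherwise runs $\mathrm{S}^{\mathrm{proc}}$ with $\bar{\mathrm{q}}$ bound to the value of $\mathrm{s}$. $\llbracket\mathrm{P}\rrbracket(|\psi\rangle)$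 is the final state when the main statement, started on $|\psi\rangle$ with $l=[1,\dots,n]$, $A=\{1,\dots,n\}$, terminates without error. The class $\textsc{pbp}$. Write $\mathrm{proc}_1\to\mathrm{proc}_2$ if $\mathrm{proc}_2$ is called in $\mathrm{S}^{\mathrm{proc}_1}$, $\succeq$ for its transitive closure, and $\mathrm{proc}\sim\mathrm{proc}'$ if $\mathrm{proc}\succeq\mathrm{proc}'$ and $\mathrm{proc}'\succeq\mathrm{proc}$; $\mathrm{proc}$ is recursive if $\mathrm{proc}\sim\mathrm{proc}$. The width of $\mathrm{proc}$ is $w^{\mathrm{proc}}(\mathrm{S}^{\mathrm{proc}})$, where $w^{\mathrm{proc}}$ is $0$ on skip and unitary application, additive on sequences, the maximum over the two branches for $\mathbf{if}$ and $\mathbf{qcase}$, and on $\mathbf{call}\ \mathrm{proc}'(\mathrm{s})$ equals $1$ if $\mathrm{proc}\sim\mathrm{proc}'$ and $0$ otherwise. $\textsc{pbp}$ is the set of programs that are (i) well-founded: every call to a procedure $\mathrm{proc}'$ inside $\mathrm{S}^{\mathrm{proc}}$ with $\mathrm{proc}\sim\mathrm{proc}'$ removes at least one qubit from its parameter; (ii) of width at most $1$ for every procedure; (iii) basic: every procedure call is performed either on the variable $\bar{\mathrm{q}}$ or on one single sorted-set expression $\mathrm{s}$ fixed for the whole program. The compilation $\mathbf{compile}(\mathrm{P},n)$ produces a quantum circuit on $n$ input qubits plus ancillas, by recursion on controlled statements $(cs,\mathrm{S})$, where a control structure $cs$ is a partial map from qubit indices to $\{0,1\}$ (the gate is applied only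 when each qubit $k\in\mathrm{dom}(cs)$ is in state $|cs(k)\rangle$), starting from the empty control structure and the main statement with list $[1,\dots,n]$: skip gives the empty circuit; a unitary application gives the corresponding gate controlled by $cs$; a sequence gives the concatenation; a classical conditional compiles the (classically evaluated) chosen branch; $\mathbf{qcase}$ on qubit $k$ compiles $(cs[k:=0],\mathrm{S}_0)$ followed by $(cs[k:=1],\mathrm{S}_1)$; a call to a non-recursive procedure inlines its body; for recursive procedures, calls are compiled by anchoring and merging: for each pair (procedure name, input size $m$) at most one ancilla $a^{\mathrm{proc}}_m$ (initialized to $|0\rangle$) is created; the first such call is compiled as a $cs$-controlled NOT onto the ancilla, the body compiled under control $a=1$, and another $cs$-controlled NOT onto the ancilla; any later call with the same name and input size only adds $cs$-controlled NOTs onto that same ancilla before and after the single compiled body, statements without recursive calls being commuted out of the way. $\llbracket C\rrbracket(|\psi\rangle)$ denotes the state of the $n$ input qubits obtained by applying the gates of $C$ in order to $|\psi\rangle$ with all ancillas initialized to $|0\rangle$. *)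

(* Defs.v *)
From mathcomp Require Import all_boot all_order all_algebra.
From mathcomp Require Import spectral complex.
From mathcomp Require Import reals trigo.

Set Implicit Arguments.
Unset Strict Implicit.
Unset Printing Implicit Defensive.

Import Order.TTheory GRing.Theory Num.Theory.
Local Open Scope ring_scope.

Notation "'olet' x ':=' e 'in' f" := (obind (fun x => f) e)
  (at level 200, x name, e at level 100, f at level 200, only parsing).

(** * Polynomial-time approximable functions *)

(* Deterministic single-tape Turing machines over {0, 1, blank}, the blank
   being [None].  [tm_step q c] is [None] to halt, and otherwise gives the next
   state, the symbol written, and the direction of the move ([true]: right). *)
Record tmachine := TMachine {
  tm_state : finType;
  tm_start : tm_state;
  tm_step : tm_state -> option bool -> option (tm_state * option bool * bool)
}.

(* [(q, lt, rt)]: [lt] is the tape to the left of the head, nearest cell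
   first; [rt] is the tape from the scanned cell rightwards; all the cells
   beyond these are blank. *)
Definition tm_config (M : tmachine) : Type :=
  (tm_state M * seq (option bool) * seq (option bool))%type.

Definition tm_next (M : tmachine) (c : tm_config M) : option (tm_config M) :=
  let: (q, lt, rt) := c in
  if tm_step q (head None rt) is Some (q', w, dir) then
    Some (if dir then (q', w :: lt, behead rt)
          else (q', behead lt, head None lt :: w :: behead rt))
  else None.

(* The halting configuration, if it is reached in at most [t] steps. *)
Fixpoint tm_run (M : tmachine) (t : nat) (c : tm_config M) :
    option (tm_config M) :=
  if tm_next c is Some c' then if t is t'.+1 then tm_run t' c' else None
  else Some c.

(* Little-endian binary notation. *)
Definition nat_bits (m : nat) : seq bool :=
  mkseq (fun i => odd (m %/ 2 ^ i)) (trunc_log 2 m).+1.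

Definition bits_nat (s : seq bool) : nat :=
  foldr (fun (b : bool) m => b + m.*2)%N 0%N s.

(* The input (k, j): k in unary, a delimiter, the sign of j, |j| in binary. *)
Definition tm_input (k : nat) (j : int) : seq bool :=
  nseq k true ++ false :: (j < 0) :: nat_bits `|j|%N.

(* The output is read from the head rightwards, up to the first blank. *)
Fixpoint tm_output (rt : seq (option bool)) : seq bool :=
  if rt is Some b :: rt' then b :: tm_output rt' else [::].

(* Some machine computes, in time polynomial in the size of [tm_input k j], an
   integer m such that m / 2^k is within 2^-k of f j. *)
Definition poly_time_approximable (R : realType) (f : int -> R) : Prop :=
  exists (M : tmachine) (c d : nat), forall (k : nat) (j : int),
    let x := tm_input k j in
    exists2 h : tm_config M,
      tm_run (c * size x ^ d)%N (tm_start M, [::], map some x) = Some h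
      & `|(bits_nat (tm_output h.2))%:R / 2 ^+ k - f j| <= 2 ^- k.

Record angle_fun (R : realType) := AngleFun {
  angle :> int -> R;
  angle_range : forall k, 0 <= angle k < 2 * pi;
  angle_ptime : poly_time_approximable angle
}.

(* The fixed family of single-qubit unitaries U^f(j) of the language; row and
   column b of a matrix stand for the basis state |b>. *)
Record gate_family (R : realType) := GateFamily {
  gate_name : Type;
  gate_mx : gate_name -> angle_fun R -> int -> 'M[R[i]]_2;
  gate_unitary : forall u f j, gate_mx u f j \is unitarymx
}.

(** * Syntax *)

(* [QBar] is the sorted-set variable \bar q; integer variables are named by natural
   numbers. *)
Inductive iexp : Type :=
  | IVar of nat
  | IConst of int
  | IAdd of iexp & int
  | ISub of iexp & int
  | ISize of sexp
with sexp : Type :=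
  | QBar
  | SMinus of sexp & iexp.

Inductive bexp : Type :=
  | BGt of iexp & iexp
  | BGe of iexp & iexp
  | BEq of iexp & iexp
  | BNot of bexp
  | BAnd of bexp & bexp
  | BOr of bexp & bexp.

(* s[i] *)
Inductive qexp : Type := QNth of sexp & iexp.

Inductive stmt (R : realType) (G : gate_family R) (proc : Type) : Type :=
  | Skip
  | Unitary of qexp & gate_name G & angle_fun R & iexp
  | Seq of stmt G proc & stmt G proc
  | If of bexp & stmt G proc & stmt G proc
  | QCase of qexp & stmt G proc & stmt G proc
  | Call of proc & sexp.

Arguments Skip {R G proc}.
Arguments Unitary {R G proc}.
Arguments Seq {R G proc}.
Arguments If {R G proc}.
Arguments QCase {R G proc}.
Arguments Call {R G proc}.

(* The declared procedure names form a finite type, so that each name has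
   exactly one declaration and every called procedure is declared. *)
Record program (R : realType) (G : gate_family R) := Program {
  proc : finType;
  body : proc -> stmt G proc;
  main : stmt G proc
}.
Arguments body {R G} _ _.
Arguments main {R G} _.

(** * Evaluation of expressions *)

(* Positions in lists are counted from 1. *)
Definition in_range (i : int) (m : nat) : bool := (1 <= i) && (i <= m%:Z).

Fixpoint ieval (T : Type) (rho : nat -> int) (l : seq T) (i : iexp) : int :=
  match i with
  | IVar x => rho x
  | IConst c => c
  | IAdd i c => ieval rho l i + c
  | ISub i c => ieval rho l i - c
  | ISize s => (size (seval rho l s))%:Z
  end
with seval (T : Type) (rho : nat -> int) (l : seq T) (s : sexp) : seq T :=
  match s with
  | QBar => l
  | SMinus s i =>
      let l' := seval rho l s in
      let p := ieval rho l i in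
      if in_range p (size l') then take `|p|.-1 l' ++ drop `|p| l' else [::]
  end.

(* [None] when the position is out of range. *)
Definition qeval (T : Type) (rho : nat -> int) (l : seq T) (q : qexp) :
    option T :=
  let: QNth s i := q in
  let l' := seval rho l s in
  let p := ieval rho l i in
  if in_range p (size l') then onth l' `|p|.-1 else None.

Fixpoint beval (T : Type) (rho : nat -> int) (l : seq T) (b : bexp) : bool :=
  match b with
  | BGt i j => ieval rho l i > ieval rho l j
  | BGe i j => ieval rho l i >= ieval rho l j
  | BEq i j => ieval rho l i == ieval rho l j
  | BNot b => ~~ beval rho l b
  | BAnd b c => beval rho l b && beval rho l c
  | BOr b c => beval rho l b || beval rho l c
  end.

(** * Quantum states *)

(* Vectors of C^(2^W), by their amplitudes in the computational basis. *)
Notation qvect R W := {ffun {ffun W -> bool} -> R[i]}.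

Definition normalized (R : realType) (W : finType) (psi : qvect R W) : Prop :=
  \sum_x `|psi x| ^+ 2 = 1.

Definition upd (W : finType) (T : Type) (x : {ffun W -> T}) (w : W) (b : T) :
    {ffun W -> T} :=
  [ffun v => if v == w then b else x v].

Definition bit (b : bool) : 'I_2 := inord b.

Definition apply1 (R : realType) (W : finType) (U : 'M[R[i]]_2) (w : W)
    (psi : qvect R W) : qvect R W :=
  [ffun x : {ffun W -> bool} =>
     \sum_(b : bool) U (bit (x w)) (bit b) * psi (upd x w b)].

(* |b>_w <b|_w psi *)
Definition proj (R : realType) (W : finType) (w : W) (b : bool)
    (psi : qvect R W) : qvect R W :=
  [ffun x : {ffun W -> bool} => if x w == b then psi x else 0].

(** * Semantics of programs *)

(* Qubit k is represented by the element k - 1 of 'I_n.  [rho] is the value of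
   the integer variables, which no statement binds or modifies.  The outcome
   [None] is an error. *)
Inductive exec (R : realType) (G : gate_family R) (P : program G)
    (rho : nat -> int) (n : nat) :
    seq 'I_n -> {set 'I_n} -> stmt G (proc P) ->
    qvect R 'I_n -> option (qvect R 'I_n) -> Prop :=
  | ExecSkip l (A : {set 'I_n}) psi : exec rho l A Skip psi (Some psi)
  | ExecUnitary l (A : {set 'I_n}) q u f j k psi :
      qeval rho l q = Some k -> k \in A ->
      exec rho l A (Unitary q u f j) psi
        (Some (apply1 (gate_mx u f (ieval rho l j)) k psi))
  | ExecUnitaryRange l (A : {set 'I_n}) q u f j psi :
      qeval rho l q = None ->
      exec rho l A (Unitary q u f j) psi None
  | ExecUnitaryAccess l (A : {set 'I_n}) q u f j k psi :
      qeval rho l q = Some k -> k \notin A ->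
      exec rho l A (Unitary q u f j) psi None
  | ExecSeq l (A : {set 'I_n}) S1 S2 psi psi1 r :
      exec rho l A S1 psi (Some psi1) ->
      exec rho l A S2 psi1 r ->
      exec rho l A (Seq S1 S2) psi r
  | ExecSeqError l (A : {set 'I_n}) S1 S2 psi :
      exec rho l A S1 psi None ->
      exec rho l A (Seq S1 S2) psi None
  | ExecIf l (A : {set 'I_n}) b S1 S2 psi r :
      exec rho l A (if beval rho l b then S1 else S2) psi r ->
      exec rho l A (If b S1 S2) psi r
  | ExecQCase l (A : {set 'I_n}) q S0 S1 k psi psi0 psi1 :
      qeval rho l q = Some k -> k \in A ->
      exec rho l (A :\ k) S0 psi (Some psi0) ->
      exec rho l (A :\ k) S1 psi (Some psi1) ->
      exec rho l A (QCase q S0 S1) psi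
        (Some (proj k false psi0 + proj k true psi1))
  | ExecQCaseRange l (A : {set 'I_n}) q S0 S1 psi :
      qeval rho l q = None ->
      exec rho l A (QCase q S0 S1) psi None
  | ExecQCaseAccess l (A : {set 'I_n}) q S0 S1 k psi :
      qeval rho l q = Some k -> k \notin A ->
      exec rho l A (QCase q S0 S1) psi None
  | ExecQCaseError l (A : {set 'I_n}) q S0 S1 k b psi :
      qeval rho l q = Some k -> k \in A ->
      exec rho l (A :\ k) (if b then S1 else S0) psi None ->
      exec rho l A (QCase q S0 S1) psi None
  | ExecCallEmpty l (A : {set 'I_n}) p s psi :
      seval rho l s = [::] ->
      exec rho l A (Call p s) psi (Some psi)
  | ExecCall l (A : {set 'I_n}) p s psi r :
      seval rho l s <> [::] ->
      exec rho (seval rho l s) A (body P p) psi r ->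
      exec rho l A (Call p s) psi r.

(* [[P]](psi) is defined and equal to [psi']. *)
Definition program_sem (R : realType) (G : gate_family R) (P : program G)
    (rho : nat -> int) (n : nat) (psi psi' : qvect R 'I_n) : Prop :=
  exec rho (enum 'I_n) setT (main P) psi (Some psi').

(** * The class PBP *)

Fixpoint calls (R : realType) (G : gate_family R) (proc : eqType) (p : proc)
    (S : stmt G proc) : bool :=
  match S with
  | Skip | Unitary _ _ _ _ => false
  | Seq S1 S2 | If _ S1 S2 | QCase _ S1 S2 => calls p S1 || calls p S2
  | Call p' _ => p' == p
  end.

(* [Q p s] holds of every [call p(s)] occurring in the statement. *)
Fixpoint all_calls (R : realType) (G : gate_family R) (proc : Type)
    (Q : proc -> sexp -> Prop) (S : stmt G proc) : Prop :=
  match S with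
  | Skip | Unitary _ _ _ _ => True
  | Seq S1 S2 | If _ S1 S2 | QCase _ S1 S2 => all_calls Q S1 /\ all_calls Q S2
  | Call p s => Q p s
  end.

Section Calls.
Context (R : realType) (G : gate_family R) (P : program G).

Definition call_rel : rel (proc P) := fun p p' => calls p' (body P p).

(* [connect] is the reflexive transitive closure: a first step makes it the
   transitive closure. *)
Definition call_trans : rel (proc P) :=
  fun p p' => [exists r, call_rel p r && connect call_rel r p'].

Definition call_sim : rel (proc P) :=
  fun p p' => call_trans p p' && call_trans p' p.

Definition recursive (p : proc P) : bool := call_sim p p.

Fixpoint width (p : proc P) (S : stmt G (proc P)) : nat :=
  match S with
  | Skip | Unitary _ _ _ _ => 0
  | Seq S1 S2 => width p S1 + width p S2
  | If _ S1 S2 | QCase _ S1 S2 => maxn (width p S1) (width p S2)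
  | Call p' _ => call_sim p p'
  end.

Definition removes_qubit (s : sexp) : bool :=
  if s is SMinus _ _ then true else false.

Definition well_founded_program : Prop :=
  forall p : proc P,
    all_calls (fun p' s => call_sim p p' -> removes_qubit s) (body P p).

Definition width_le1 : Prop :=
  forall p : proc P, (width p (body P p) <= 1)%N.

Definition basic : Prop :=
  exists s0 : sexp,
    let ok (_ : proc P) s := s = QBar \/ s = s0 in
    all_calls ok (main P) /\ forall p : proc P, all_calls ok (body P p).

Definition pbp : Prop := [/\ well_founded_program, width_le1 & basic].

End Calls.

(** * Circuits *)

(* Control structures: the partial maps from wires to {0, 1}. *)
Notation ctrl W := {ffun W -> option bool}.

Record cgate (R : realType) (W : finType) := CGate {
  g_ctrl : ctrl W;
  g_target : W;
  g_mx : 'M[R[i]]_2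
}.

Definition circuit (R : realType) (W : finType) := seq (cgate R W).

Definition active (W : finType) (cs : ctrl W) (x : {ffun W -> bool}) : bool :=
  [forall w, if cs w is Some b then x w == b else true].

Definition run_gate (R : realType) (W : finType) (phi : qvect R W)
    (g : cgate R W) : qvect R W :=
  [ffun x : {ffun W -> bool} =>
     if active (g_ctrl g) x
     then apply1 (g_mx g) (g_target g) phi x else phi x].

Definition run (R : realType) (W : finType) (C : circuit R W)
    (phi : qvect R W) : qvect R W :=
  foldl (@run_gate R W) phi C.

(* psi on the wires of I and |0> on all the wires of J. *)
Definition with_ancillas (R : realType) (I J : finType) (psi : qvect R I) :
    qvect R (I + J)%type :=
  [ffun x : {ffun I + J -> bool} =>
     if [forall a, ~~ x (inr a)] then psi [ffun i => x (inl i)] else 0].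

(* [[C]](psi) is defined and equal to [psi']: the input wires end up in the
   state [psi'], disentangled from the ancillas, which are back to |0>. *)
Definition circuit_sem (R : realType) (I J : finType)
    (C : circuit R (I + J)%type) (psi psi' : qvect R I) : Prop :=
  run C (with_ancillas J psi) = with_ancillas J psi'.

Definition not_mx (R : realType) : 'M[R[i]]_2 := \matrix_(i, j) (i != j)%:R.

Definition cnot (R : realType) (W : finType) (cs : ctrl W) (w : W) :
    cgate R W :=
  CGate cs w (not_mx R).

(** * Compilation *)

Section Compile.
Context (R : realType) (G : gate_family R) (P : program G).
Context (rho : nat -> int) (n : nat).

(* [(p, m)] is the ancilla a^p_m; lists of qubits have no duplicates, whence
   m <= n. *)
Definition ancilla : finType := (proc P * 'I_n.+1)%type.
Definition wire : finType := ('I_n + ancilla)%type.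

Definition anc (p : proc P) (m : nat) : ancilla := (p, inord m).

Definition no_ctrl : ctrl wire := [ffun=> None].
Definition ctrl_set (cs : ctrl wire) (w : wire) (b : bool) : ctrl wire :=
  upd cs w (Some b).

(* Compilation of a controlled statement on the list [l], where [ccall]
   compiles the calls on a nonempty list.  The result is [None] if some s[i]
   is out of range. *)
Fixpoint compile_stmt
    (ccall : ctrl wire -> seq 'I_n -> proc P -> option (circuit R wire))
    (S : stmt G (proc P)) (cs : ctrl wire) (l : seq 'I_n) :
    option (circuit R wire) :=
  match S with
  | Skip => Some [::]
  | Unitary q u f j =>
      olet k := qeval rho l q in
      Some [:: CGate cs (inl k) (gate_mx u f (ieval rho l j))]
  | Seq S1 S2 =>
      olet C1 := compile_stmt ccall S1 cs l in
      olet C2 := compile_stmt ccall S2 cs l in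
      Some (C1 ++ C2)
  | If b S1 S2 =>
      if beval rho l b then compile_stmt ccall S1 cs l
      else compile_stmt ccall S2 cs l
  | QCase q S0 S1 =>
      olet k := qeval rho l q in
      olet C0 := compile_stmt ccall S0 (ctrl_set cs (inl k) false) l in
      olet C1 := compile_stmt ccall S1 (ctrl_set cs (inl k) true) l in
      Some (C0 ++ C1)
  | Call p s =>
      let l' := seval rho l s in
      if nilp l' then Some [::] else ccall cs l' p
  end.

(* State of the anchoring and merging of the calls reached from a list of
   controlled statements: the circuit under construction is [cL ++ _ ++ cR],
   where the hole is to be filled with the code of the bodies in [merged];
   [created] is the set of the ancillas in use. *)
Record frame := Frame {
  cL : circuit R wire;
  cR : circuit R wire;
  merged : seq (ctrl wire * seq 'I_n * stmt G (proc P));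
  created : {set ancilla}
}.

Definition emit (C1 C2 : circuit R wire) (F : frame) : frame :=
  Frame (cL F ++ C1) (C2 ++ cR F) (merged F) (created F).

(* An anchored call: the first call with this name and input size creates the
   ancilla and schedules the body, the later ones are merged into it. *)
Definition anchor_call (p : proc P) (cs : ctrl wire) (l : seq 'I_n)
    (F : frame) : frame :=
  let a := anc p (size l) in
  let nots := [:: cnot R cs (inr a)] in
  let F' := emit nots nots F in
  if a \in created F then F' else
  Frame (cL F') (cR F')
    (rcons (merged F') (ctrl_set no_ctrl (inr a) true, l, body P p))
    (a |: created F').

(* Processes a controlled statement of width at most 1 relatively to the
   recursive procedure [p0]: the parts without recursive calls are moved to
   the left or to the right of the single recursive call. *)
Fixpoint anchor
    (ccall : ctrl wire -> seq 'I_n -> proc P -> option (circuit R wire))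
    (p0 : proc P) (S : stmt G (proc P)) (cs : ctrl wire) (l : seq 'I_n)
    (F : frame) : option frame :=
  if width p0 S == 0%N then
    olet C := compile_stmt ccall S cs l in Some (emit C [::] F)
  else
  match S with
  | Seq S1 S2 =>
      if width p0 S1 == 0%N then
        olet C1 := compile_stmt ccall S1 cs l in
        anchor ccall p0 S2 cs l (emit C1 [::] F)
      else
        olet C2 := compile_stmt ccall S2 cs l in
        anchor ccall p0 S1 cs l (emit [::] C2 F)
  | If b S1 S2 =>
      if beval rho l b then anchor ccall p0 S1 cs l F
      else anchor ccall p0 S2 cs l F
  | QCase q S0 S1 =>
      olet k := qeval rho l q in
      olet F' := anchor ccall p0 S0 (ctrl_set cs (inl k) false) l F in
      anchor ccall p0 S1 (ctrl_set cs (inl k) true) l F'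
  | Call p s =>
      let l' := seval rho l s in
      Some (if nilp l' then F else anchor_call p cs l' F)
  | Skip | Unitary _ _ _ _ => Some F
  end.

(* All the given controlled statements are processed before the bodies that
   they schedule, so that every call to be merged precedes the single compiled
   body.  In a well-founded program the input size decreases at each level, so
   it bounds the depth [d]. *)
Fixpoint optimize
    (ccall : ctrl wire -> seq 'I_n -> proc P -> option (circuit R wire))
    (p0 : proc P) (d : nat)
    (cstmts : seq (ctrl wire * seq 'I_n * stmt G (proc P)))
    (known : {set ancilla}) : option (circuit R wire) :=
  if cstmts is [::] then Some [::] else
  if d is d'.+1 then
    olet F := foldl (fun oF c => olet F := oF in
                                 anchor ccall p0 c.2 c.1.1 c.1.2 F)
                    (Some (Frame [::] [::] [::] known)) cstmts in
    olet C := optimize ccall p0 d' (merged F) (created F) in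
    Some (cL F ++ C ++ cR F)
  else None.

(* The calls compiled through [compile_call d'] are to procedures strictly
   below [p] in the call graph: #|proc P| bounds the depth [d]. *)
Fixpoint compile_call (d : nat) (cs : ctrl wire) (l : seq 'I_n)
    (p : proc P) : option (circuit R wire) :=
  if d is d'.+1 then
    if recursive p then
      let F := anchor_call p cs l (Frame [::] [::] [::] set0) in
      olet C := optimize (compile_call d') p (size l) (merged F) (created F) in
      Some (cL F ++ C ++ cR F)
    else compile_stmt (compile_call d') (body P p) cs l
  else None.

Definition compile : option (circuit R wire) :=
  compile_stmt (compile_call #|proc P|) (main P) no_ctrl (enum 'I_n).

End Compile.

(* Main.v *)
Require Import Defs.
From mathcomp Require Import all_boot all_order all_algebra.
From mathcomp Require Import complex reals zify.

(* Control flow never depends on the quantum state, so an error-free run of a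
   statement is a fixed additive operator M which is block diagonal with respect
   to the qubits that it does not touch; no accessible qubit is a control, so M
   preserves the part of the state on which the controls are active.  Every
   state met during the execution of the circuit is a sum of states |psi>|a>,
   a being a basis state of the ancillas.

   Within a class of mutually recursive procedures all calls are made on the
   same set s0, so the input list of a recursive call is determined by its size
   and merging by size is sound.  By the bound on the width, each branch sets at
   most one ancilla of each level.  Hence if a circuit C fills the hole of a
   frame L ++ _ ++ R correctly, that is, acts as the body of p when the ancilla
   of p is set and as the identity when no ancilla of its level is, then on the
   active part of a statement L ++ C ++ R acts as the statement, while elsewhere
   L and R act as the identity.  Nesting these holes, level after level, gives
   the correctness of anchoring and merging. *)

Set Implicit Arguments.
Unset Strict Implicit.
Unset Printing Implicit Defensive.

Import GRing.Theory.
Local Open Scope ring_scope.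

(** * States of qubits and ancillas *)

Section Registers.
Context (W : finType).

Lemma updE T (x : {ffun W -> T}) w b v :
  upd x w b v = if v == w then b else x v.
Proof. by rewrite ffunE. Qed.

Lemma upd_same T (x : {ffun W -> T}) w b : upd x w b w = b.
Proof. by rewrite updE eqxx. Qed.

Lemma upd_other T (x : {ffun W -> T}) w b v : v != w -> upd x w b v = x v.
Proof. by rewrite updE => /negPf->. Qed.

Lemma upd_upd T (x : {ffun W -> T}) w b c : upd (upd x w b) w c = upd x w c.
Proof. by apply/ffunP=> v; rewrite !updE; case: eqP. Qed.

Lemma upd_id T (x : {ffun W -> T}) w : upd x w (x w) = x.
Proof. by apply/ffunP=> v; rewrite updE; case: eqP => [->|]. Qed.

Lemma active_upd (cs : ctrl W) (x : {ffun W -> bool}) w b :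
  cs w = None -> active cs (upd x w b) = active cs x.
Proof.
move=> csw; apply: eq_forallb => v; rewrite updE.
by case: (v =P w) => [->|//]; rewrite csw.
Qed.

Lemma active_upd_some (cs : ctrl W) (x : {ffun W -> bool}) w b :
  cs w = None -> active (upd cs w (Some b)) x = active cs x && (x w == b).
Proof.
move=> csw; apply/forallP/andP => [act | [/forallP act xw] v]; last first.
  by rewrite updE; case: (v =P w) => [->|_] //; apply: act.
split; last by have := act w; rewrite upd_same.
apply/forallP=> v; have := act v; rewrite updE.
by case: (v =P w) => [->|//]; rewrite csw.
Qed.

End Registers.

Section States.
Context (R : realType) (W : finType).
Implicit Types (psi : qvect R W).

Lemma projE w b psi x : proj w b psi x = if x w == b then psi x else 0.
Proof. by rewrite ffunE. Qed.

Lemma proj_split w psi : psi = proj w false psi + proj w true psi.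
Proof.
by apply/ffunP=> x; rewrite !ffunE; case: (x w); rewrite /= ?addr0 ?add0r.
Qed.

Lemma projD w b psi psi' : proj w b (psi + psi') = proj w b psi + proj w b psi'.
Proof. by apply/ffunP=> x; rewrite !ffunE; case: ifP => _ //; rewrite addr0. Qed.

Lemma projC w b v c psi : proj w b (proj v c psi) = proj v c (proj w b psi).
Proof. by apply/ffunP=> x; rewrite !ffunE; do 2!case: eqP. Qed.

Lemma apply1D U w psi psi' :
  apply1 U w (psi + psi') = apply1 U w psi + apply1 U w psi'.
Proof.
apply/ffunP=> x; rewrite !ffunE -big_split /=.
by apply: eq_bigr => b _; rewrite ffunE mulrDr.
Qed.

Lemma apply1_proj U w v b psi : v != w ->
  apply1 U w (proj v b psi) = proj v b (apply1 U w psi).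
Proof.
move=> vw; apply/ffunP=> x; rewrite projE !ffunE.
case: ifP => xv; last (apply: big1 => c _); try apply: eq_bigr => c _;
  by rewrite projE upd_other // xv ?mulr0.
Qed.

Lemma apply1E U w psi x :
  apply1 U w psi x = \sum_(b : bool) U (bit (x w)) (bit b) * psi (upd x w b).
Proof. by rewrite ffunE. Qed.

Lemma run_gateE psi (g : cgate R W) x :
  run_gate psi g x = if active (g_ctrl g) x
                     then apply1 (g_mx g) (g_target g) psi x else psi x.
Proof. by rewrite ffunE. Qed.

Lemma run_gateD (g : cgate R W) psi psi' :
  run_gate (psi + psi') g = run_gate psi g + run_gate psi' g.
Proof.
by apply/ffunP=> x; rewrite [RHS]ffunE !run_gateE apply1D !ffunE; case: ifP.
Qed.

Lemma runD (C : circuit R W) psi psi' :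
  run C (psi + psi') = run C psi + run C psi'.
Proof. by elim: C psi psi' => //= g C IH psi psi'; rewrite run_gateD IH. Qed.

Lemma run_cat (C1 C2 : circuit R W) psi : run (C1 ++ C2) psi = run C2 (run C1 psi).
Proof. exact: foldl_cat. Qed.

(** Since the target is not a control, changing its bit keeps a basis state active, so the gate only
    mixes amplitudes that vanish. *)
Lemma run_gate_id (g : cgate R W) psi :
  g_ctrl g (g_target g) = None ->
  (forall x, active (g_ctrl g) x -> psi x = 0) ->
  run_gate psi g = psi.
Proof.
move=> gt psi0; apply/ffunP=> x; rewrite !ffunE; case: ifP => // act.
by rewrite psi0 // big1 // => b _; rewrite psi0 ?mulr0 // active_upd.
Qed.

Definition supported (D : {ffun W -> bool} -> bool) psi : Prop :=
  forall x, ~~ D x -> psi x = 0.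

Lemma supported_sub (D D' : {ffun W -> bool} -> bool) psi :
  (forall x, D x -> D' x) -> supported D psi -> supported D' psi.
Proof. by move=> sub sup x /(contra (sub x)); apply: sup. Qed.

Lemma supported_proj (D : {ffun W -> bool} -> bool) w b psi :
  supported D psi -> supported (fun x => D x && (x w == b)) (proj w b psi).
Proof.
move=> sup x; rewrite projE negb_and => /orP[/sup-> | /negPf->] //.
by rewrite if_same.
Qed.

(* The additive operators that are block diagonal with respect to the values of
   the qubits outside of [B]. *)
Definition acts_within (B : {set W}) (M : qvect R W -> qvect R W) : Prop :=
  {morph M : psi psi' / psi + psi'} /\
  forall k b psi, k \notin B -> M (proj k b psi) = proj k b (M psi).

Lemma acts_within0 B M : acts_within B M -> M 0 = 0.
Proof. by case=> MD _; apply: (addrI (M 0)); rewrite -MD !addr0. Qed.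

End States.

Section Ancillas.
Context (R : realType) (I J : finType).
Implicit Types (psi : qvect R I) (q : {ffun I -> bool}) (a : {ffun J -> bool}).
Implicit Types (cs : ctrl (I + J)%type).

Definition join q a : {ffun I + J -> bool} :=
  [ffun w => match w with inl i => q i | inr j => a j end].

Lemma join_split (x : {ffun I + J -> bool}) :
  x = join [ffun i => x (inl i)] [ffun j => x (inr j)].
Proof. by apply/ffunP=> -[i|j]; rewrite !ffunE. Qed.

Lemma joinP (phi phi' : qvect R (I + J)%type) :
  (forall q a, phi (join q a) = phi' (join q a)) -> phi = phi'.
Proof. by move=> eqp; apply/ffunP=> x; rewrite (join_split x). Qed.

Lemma upd_join_l q a i b : upd (join q a) (inl i) b = join (upd q i b) a.
Proof. by apply/ffunP=> -[j|j]; rewrite !ffunE. Qed.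

Lemma upd_join_r q a j b : upd (join q a) (inr j) b = join q (upd a j b).
Proof. by apply/ffunP=> -[i|i]; rewrite !ffunE. Qed.

(* |psi>|a> *)
Definition embed psi a : qvect R (I + J)%type :=
  [ffun x : {ffun I + J -> bool} =>
     if [ffun j => x (inr j)] == a then psi [ffun i => x (inl i)] else 0].

Lemma embedE psi a q b : embed psi a (join q b) = if b == a then psi q else 0.
Proof.
rewrite ffunE; have -> : [ffun j => join q b (inr j)] = b.
  by apply/ffunP=> j; rewrite !ffunE.
by have -> : [ffun i => join q b (inl i)] = q by apply/ffunP=> j; rewrite !ffunE.
Qed.

Lemma embedD psi psi' a : embed (psi + psi') a = embed psi a + embed psi' a.
Proof.
apply: joinP => q b; rewrite [RHS]ffunE !embedE.
by case: ifP; rewrite ?ffunE ?addr0.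
Qed.

Lemma with_ancillas_embed psi : with_ancillas J psi = embed psi [ffun=> false].
Proof.
apply/ffunP=> x; rewrite !ffunE; congr (if _ then _ else _).
apply/forallP/eqP => [x0 | /ffunP x0 j].
  by apply/ffunP=> j; rewrite !ffunE; apply/negbTE.
by have := x0 j; rewrite !ffunE => ->.
Qed.

Definition act cs a q : bool := active cs (join q a).

Lemma act_upd cs a q z b : cs (inr z) = None -> act cs (upd a z b) q = act cs a q.
Proof. by rewrite /act -upd_join_r; apply: active_upd. Qed.

Lemma act_ctrl_l cs a q k b : cs (inl k) = None ->
  act (upd cs (inl k) (Some b)) a q = act cs a q && (q k == b).
Proof. by move=> csk; rewrite /act active_upd_some // ffunE. Qed.

Lemma supported_ctrl_l cs a k b psi : cs (inl k) = None ->
  supported (act (upd cs (inl k) (Some b)) a) psi -> supported (act cs a) psi.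
Proof. by move=> csk; apply: supported_sub => q; rewrite act_ctrl_l // => /andP[]. Qed.

Lemma supported_act_proj cs a k b psi : cs (inl k) = None ->
  supported (act cs a) psi ->
  supported (act (upd cs (inl k) (Some b)) a) (proj k b psi).
Proof.
move=> csk /(@supported_proj _ _ _ k b); apply: supported_sub => q.
by rewrite act_ctrl_l.
Qed.

(** Makes the code of either branch of a quantum case idle on the part of the state that the other
    branch treats. *)
Lemma supported_inact_ctrl cs a k b c psi : cs (inl k) = None -> b != c ->
  supported (act (upd cs (inl k) (Some b)) a) psi ->
  supported (predC (act (upd cs (inl k) (Some c)) a)) psi.
Proof.
move=> csk bc; apply: supported_sub => q; rewrite /= !act_ctrl_l //.
by case/andP=> _ /eqP->; rewrite negb_and bc orbT.
Qed.

Lemma supported_inact_ctrl_l cs a k b psi : cs (inl k) = None ->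
  supported (predC (act cs a)) psi ->
  supported (predC (act (upd cs (inl k) (Some b)) a)) psi.
Proof.
by move=> csk; apply: supported_sub => q /=; rewrite act_ctrl_l // negb_and => ->.
Qed.

Lemma supported_act_upd cs a z b psi : cs (inr z) = None ->
  supported (act cs a) psi -> supported (act cs (upd a z b)) psi.
Proof. by move=> csz; apply: supported_sub => q; rewrite act_upd. Qed.

Definition free_on cs (B : {set I}) : Prop := forall k, k \in B -> cs (inl k) = None.

(** A controlled qubit lies outside of [B], so [M] commutes with the projection onto its prescribed
    value, which fixes [psi]. A violated control on an ancilla leaves no active basis state, whence
    [psi] is 0. *)
Lemma acts_within_supported cs a B M psi :
  acts_within B M -> free_on cs B ->
  supported (act cs a) psi -> supported (act cs a) (M psi).
Proof.
move=> MB csB sup q; rewrite negb_forall => /existsP[w].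
case csw: (cs w) => [b|//] qw.
have psi0 x : join x a w != b -> psi x = 0.
  move=> xw; apply: sup; rewrite negb_forall; apply/existsP; exists w.
  by rewrite csw.
case: w csw qw psi0 => [k|z] csw; rewrite ffunE => qw psi0.
  have psiE : psi = proj k b psi.
    by apply/ffunP=> x; rewrite projE; case: ifPn => // xk; rewrite psi0 ?ffunE.
  have kB : k \notin B by apply/negP=> /csB; rewrite csw.
  by case: MB => _ /(_ k b psi kB); rewrite -psiE => ->; rewrite projE (negPf qw).
have -> : psi = 0 by apply/ffunP=> x; rewrite psi0 !ffunE.
by rewrite (acts_within0 MB) ffunE.
Qed.

Lemma run_gate_inactive cs w U a psi : cs w = None ->
  supported (predC (act cs a)) psi ->
  run_gate (embed psi a) (CGate cs w U) = embed psi a.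
Proof.
move=> csw sup; apply: run_gate_id => //= x; rewrite (join_split x) embedE.
by case: eqP => // -> cx; apply: sup; rewrite /= negbK.
Qed.

Lemma run_gate_qubit cs k U a psi : cs (inl k) = None ->
  supported (act cs a) psi ->
  run_gate (embed psi a) (CGate cs (inl k) U) = embed (apply1 U k psi) a.
Proof.
move=> csk sup; apply: joinP => q b; rewrite run_gateE /= apply1E !embedE ffunE.
have [->|ba] := eqVneq b a; last first.
  rewrite big1 ?if_same // => c _.
  by rewrite upd_join_l embedE (negPf ba) mulr0.
rewrite apply1E; case: ifPn => [_|nact].
  by apply: eq_bigr => c _; rewrite upd_join_l embedE eqxx.
rewrite sup // big1 // => c _; rewrite sup ?mulr0 //.
by rewrite /act -upd_join_l active_upd.
Qed.

Lemma run_cnot cs z a psi : cs (inr z) = None ->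
  supported (act cs a) psi ->
  run_gate (embed psi a) (cnot R cs (inr z)) = embed psi (upd a z (~~ a z)).
Proof.
move=> csz sup; apply: joinP => q b; rewrite run_gateE /= apply1E !embedE.
(* The amplitude at [b] comes from [b] with bit [z] flipped, and flipping is an involution. *)
have bE : (b == upd a z (~~ a z)) = (upd b z (~~ b z) == a).
  apply/eqP/eqP=> [->|<-]; apply/ffunP=> v; rewrite !updE eqxx;
  by case: (v =P z) => [->|//]; rewrite negbK.
case: ifPn => [_|nact]; last first.
  case: eqP => [ba|_]; first by rewrite [psi q]sup ?if_same // /act -ba.
  by case: eqP => // ba; rewrite [psi q]sup // -(act_upd a q (~~ a z) csz) -ba.
rewrite (bigD1 (~~ b z)) //= upd_join_r embedE -bE ffunE big1 => [|c cb].
  rewrite addr0 /not_mx mxE -(inj_eq val_inj) /= !inordK ?ltnS ?leq_b1 //.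
  by case: (b z); rewrite mul1r.
rewrite /not_mx mxE; have -> : c = b z by case: (c) (b z) cb => [] [].
by rewrite eqxx mul0r.
Qed.

End Ancillas.

(** * Sizes of sorted sets and the call graph *)

Lemma size_seval (T : Type) rho (l : seq T) s : (size (seval rho l s) <= size l)%N.
Proof.
elim: s => [|s IH i] //=; case: ifP => // _.
rewrite size_cat size_drop size_take; apply: leq_trans IH.
by case: ltnP; lia.
Qed.

(** An index out of range yields the empty list, which is shorter too because [l] is not empty. *)
Lemma size_seval_removes (T : Type) rho (l : seq T) s :
  removes_qubit s -> l <> [::] -> (size (seval rho l s) < size l)%N.
Proof.
case: s => [|s i] //= _ l0; case: ifP => [|_]; last by case: l l0.
rewrite /in_range => /andP[i1 im]; apply: leq_trans (size_seval rho l s).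
move: i1 im; set p := ieval rho l i; set m := seval rho l s.
rewrite size_cat size_drop size_take.
case: p => [[|k]|k] //= _; rewrite lez_nat => km.
by rewrite km; lia.
Qed.

Section CallGraph.
Context (R : realType) (G : gate_family R) (P : program G).
Implicit Types p : proc P.

(** Constant on a class of mutually recursive procedures and smaller for a callee outside of the
    class, this measure stratifies both the recursion of the compiler and the ancillas. *)
Definition rank p : nat := #|connect (@call_rel _ _ P) p|.

Lemma rank_le_card p : (rank p <= #|proc P|)%N.
Proof. exact: max_card. Qed.

Lemma call_trans_connect p p' : call_trans p p' -> connect (@call_rel _ _ P) p p'.
Proof. by case/existsP=> r /andP[/connect1 pr]; apply: connect_trans. Qed.

Lemma connect_call_trans p q r :
  connect (@call_rel _ _ P) p q -> call_trans q r -> call_trans p r.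
Proof.
case/connectP=> -[|p' w] /= => [_ ->//|/andP[pp' w_path] ->] qr.
apply/existsP; exists p'; rewrite pp' /=.
apply: connect_trans (call_trans_connect qr).
by apply/connectP; exists w.
Qed.

Lemma call_sim_sym p q : call_sim p q = call_sim q p.
Proof. by rewrite /call_sim andbC. Qed.

Lemma call_sim_trans p q r : call_sim p q -> call_sim q r -> call_sim p r.
Proof.
case/andP=> pq qp /andP[qr rq]; apply/andP; split.
  exact: connect_call_trans (call_trans_connect pq) qr.
exact: connect_call_trans (call_trans_connect rq) qp.
Qed.

Lemma call_sim_eq p q : call_sim p q -> call_sim p =1 call_sim q.
Proof.
move=> pq r; apply/idP/idP; apply: call_sim_trans => //.
by rewrite call_sim_sym.
Qed.

(** The width depends on the class only, so one representative [p0] serves for all the bodies of its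
    class. *)
Lemma width_sim p q S : call_sim p q -> width p S = width q S.
Proof.
by move=> /call_sim_eq pq; elim: S => //= [S1 -> S2 ->|b S1 -> S2 ->|k S1 -> S2 ->|r _] //;
  rewrite pq.
Qed.

Lemma rank_connect p q : connect (@call_rel _ _ P) p q -> (rank q <= rank p)%N.
Proof.
move=> pq; apply/subset_leq_card/subsetP => r; rewrite !inE.
exact: connect_trans.
Qed.

Lemma rank_sim p q : call_sim p q -> rank p = rank q.
Proof.
case/andP=> /call_trans_connect pq /call_trans_connect qp.
by apply/eqP; rewrite eqn_leq !rank_connect.
Qed.

(** The callee reaches only what the caller reaches, but not the caller itself: otherwise the two
    would be mutually recursive. *)
Lemma rank_call p q : calls q (body P p) -> ~~ call_sim p q -> (rank q < rank p)%N.
Proof.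
move=> pq npq; have tpq : call_trans p q.
  by apply/existsP; exists q; rewrite /call_rel pq connect0.
apply/proper_card/properP; split.
  by apply/subsetP=> r; rewrite !inE; apply: connect_trans (call_trans_connect tpq).
exists p; rewrite !inE ?connect0 //; apply: contra npq => qp.
rewrite /call_sim tpq; move: qp; case/connectP=> -[|r w] /= => [_ qp|/andP[qr rw] pE].
  by move: tpq; rewrite qp.
by apply/existsP; exists r; rewrite qr; apply/connectP; exists w.
Qed.

End CallGraph.

Section AllCalls.
Context (R : realType) (G : gate_family R).

Lemma all_calls_sub (proc : eqType) (Q Q' : proc -> sexp -> Prop) (S : stmt G proc) :
  (forall p s, calls p S -> Q p s -> Q' p s) -> all_calls Q S -> all_calls Q' S.
Proof.
elim: S => //= [S1 IH1 S2 IH2|_ S1 IH1 S2 IH2|_ S1 IH1 S2 IH2|p s] sub;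
  try (case=> Q1 Q2; split; [apply: IH1 Q1|apply: IH2 Q2] => p s c;
       by apply: sub; rewrite c ?orbT).
by apply: sub; rewrite eqxx.
Qed.

Lemma all_calls_and (proc : Type) (Q Q' : proc -> sexp -> Prop) (S : stmt G proc) :
  all_calls Q S -> all_calls Q' S -> all_calls (fun p s => Q p s /\ Q' p s) S.
Proof. by elim: S => //= [S1 IH1 S2 IH2|_ S1 IH1 S2 IH2|_ S1 IH1 S2 IH2] [? ?] [? ?]; auto. Qed.

Lemma all_calls_true (proc : Type) (Q : proc -> sexp -> Prop) (S : stmt G proc) :
  (forall p s, Q p s) -> all_calls Q S.
Proof. by move=> QT; elim: S => /=. Qed.

End AllCalls.

(** * Programs as operators *)

Section Denotation.
Context (R : realType) (G : gate_family R) (P : program G).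
Context (rho : nat -> int) (n : nat).
Implicit Types (l : seq 'I_n) (S : stmt G (proc P)).

(* The control flow does not depend on the state, so an error-free run of [S]
   is a fixed operator [M]; [B] collects the
   targets of its unitaries and of its quantum cases. *)
Inductive denotes : seq 'I_n -> stmt G (proc P) ->
    (qvect R 'I_n -> qvect R 'I_n) -> {set 'I_n} -> Prop :=
  | DenSkip l : denotes l Skip id set0
  | DenUnitary l q u f j k :
      qeval rho l q = Some k ->
      denotes l (Unitary q u f j) (apply1 (gate_mx u f (ieval rho l j)) k) [set k]
  | DenSeq l S1 S2 M1 M2 B1 B2 :
      denotes l S1 M1 B1 -> denotes l S2 M2 B2 ->
      denotes l (Seq S1 S2) (fun psi => M2 (M1 psi)) (B1 :|: B2)
  | DenIf l b S1 S2 M B :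
      denotes l (if beval rho l b then S1 else S2) M B ->
      denotes l (If b S1 S2) M B
  | DenQCase l q S0 S1 k M0 M1 B0 B1 :
      qeval rho l q = Some k -> k \notin B0 :|: B1 ->
      denotes l S0 M0 B0 -> denotes l S1 M1 B1 ->
      denotes l (QCase q S0 S1)
        (fun psi => proj k false (M0 psi) + proj k true (M1 psi)) (k |: (B0 :|: B1))
  | DenCallEmpty l p s :
      seval rho l s = [::] -> denotes l (Call p s) id set0
  | DenCall l p s M B :
      seval rho l s <> [::] -> denotes (seval rho l s) (body P p) M B ->
      denotes l (Call p s) M B.

(** A quantum case removes its qubit from the accessible set, which bounds the targets of the
    branches; this gives the side condition of [DenQCase]. *)
Lemma exec_denotes l (A : {set 'I_n}) S psi r : exec rho l A S psi r ->
  if r is Some psi' then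
    exists M B, [/\ denotes l S M B, B \subset A & psi' = M psi]
  else True.
Proof.
elim=> {l A S psi r} //.
- by move=> l A psi; exists id, set0; split=> //; [apply: DenSkip | apply: sub0set].
- move=> l A q u f j k psi qk kA; exists (apply1 (gate_mx u f (ieval rho l j)) k), [set k].
  by split=> //; [apply: DenUnitary | rewrite sub1set].
- move=> l A S1 S2 psi psi1 [psi2|//] _ [M1 [B1 [d1 s1 ->]]] _ [M2 [B2 [d2 s2 ->]]].
  exists (fun psi => M2 (M1 psi)), (B1 :|: B2); split=> //; first exact: DenSeq.
  by rewrite subUset s1.
- move=> l A b S1 S2 psi [psi'|//] _ [M [B [d s ->]]].
  by exists M, B; split=> //; apply: DenIf.
- move=> l A q S0 S1 k psi psi0 psi1 qk kA _ [M0 [B0 [d0 s0 ->]]] _ [M1 [B1 [d1 s1 ->]]].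
  have s : B0 :|: B1 \subset A :\ k by rewrite subUset s0.
  exists (fun psi => proj k false (M0 psi) + proj k true (M1 psi)), (k |: (B0 :|: B1)).
  split=> //; last by rewrite subUset sub1set kA (subset_trans s (subD1set _ _)).
  by apply: DenQCase => //; apply/negP=> /(subsetP s); rewrite !inE eqxx.
- by move=> l A p s psi l0; exists id, set0; split; rewrite ?sub0set //; apply: DenCallEmpty.
- move=> l A p s psi [psi'|//] l0 _ [M [B [d sB ->]]].
  by exists M, B; split=> //; apply: DenCall.
Qed.

Lemma denotes_inv l S M B : denotes l S M B ->
  match S with
  | Skip => M = id /\ B = set0
  | Unitary q u f j => exists k,
      [/\ qeval rho l q = Some k,
          M = apply1 (gate_mx u f (ieval rho l j)) k & B = [set k]]
  | Seq S1 S2 => exists M1 M2 B1 B2,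
      [/\ denotes l S1 M1 B1, denotes l S2 M2 B2,
          M = (fun psi => M2 (M1 psi)) & B = B1 :|: B2]
  | If b S1 S2 => denotes l (if beval rho l b then S1 else S2) M B
  | QCase q S0 S1 => exists k M0 M1 B0 B1,
      [/\ qeval rho l q = Some k, k \notin B0 :|: B1,
          denotes l S0 M0 B0 /\ denotes l S1 M1 B1,
          M = (fun psi => proj k false (M0 psi) + proj k true (M1 psi))
        & B = k |: (B0 :|: B1)]
  | Call p s => [/\ seval rho l s = [::], M = id & B = set0] \/
      seval rho l s <> [::] /\ denotes (seval rho l s) (body P p) M B
  end.
Proof.
case=> {l S M B} //.
- by move=> l q u f j k qk; exists k.
- by move=> l S1 S2 M1 M2 B1 B2 d1 d2; exists M1, M2, B1, B2.
- by move=> l q S0 S1 k M0 M1 B0 B1 qk kB d0 d1; exists k, M0, M1, B0, B1.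
- by left.
- by right.
Qed.

Lemma denotes_det l S M B M' B' :
  denotes l S M B -> denotes l S M' B' -> M = M' /\ B = B'.
Proof.
move=> d; elim: d M' B' => {l S M B}.
- by move=> l M' B' /denotes_inv[-> ->].
- by move=> l q u f j k qk M' B' /denotes_inv[k' []]; rewrite qk => -[->] -> ->.
- by move=> l S1 S2 M1 M2 B1 B2 _ IH1 _ IH2 M' B'
    /denotes_inv[M1' [M2' [B1' [B2' [/IH1[<- <-] /IH2[<- <-] -> ->]]]]].
- by move=> l b S1 S2 M B _ IH M' B' /denotes_inv /IH.
- move=> l q S0 S1 k M0 M1 B0 B1 qk _ _ IH0 _ IH1 M' B'.
  case/denotes_inv=> k' [M0' [M1' [B0' [B1' [qk' _ [/IH0[<- <-] /IH1[<- <-]] -> ->]]]]].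
  by move: qk'; rewrite qk => -[->].
- by move=> l p s s0 M' B' /denotes_inv[[_ -> ->]|[]].
- by move=> l p s M B s0 _ IH M' B' /denotes_inv[[]|[_ /IH]].
Qed.

Lemma denotes_within l S M B : denotes l S M B -> acts_within B M.
Proof.
elim=> {l S M B} //.
- move=> l q u f j k _; split=> [psi psi'|v b psi]; first exact: apply1D.
  by rewrite inE; apply: apply1_proj.
- move=> l S1 S2 M1 M2 B1 B2 _ [D1 p1] _ [D2 p2].
  split=> [psi psi'|v b psi]; first by rewrite D1 D2.
  by rewrite inE negb_or => /andP[v1 v2]; rewrite p1 // p2.
- move=> l q S0 S1 k M0 M1 B0 B1 _ _ _ [D0 p0] _ [D1 p1].
  split=> [psi psi'|v b psi]; first by rewrite D0 D1 !projD addrACA.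
  rewrite !inE !negb_or => /and3P[_ v1 v2]; rewrite p0 // p1 //.
  by rewrite projD ![proj k _ (proj v _ _)]projC.
Qed.

(** The semantics projects after running the branches, whereas in the circuit each branch acts on
    its own part of the state; block diagonality reconciles the two. *)
Lemma qcase_within k (M0 M1 : qvect R 'I_n -> qvect R 'I_n) B0 B1 psi :
  k \notin B0 :|: B1 -> acts_within B0 M0 -> acts_within B1 M1 ->
  proj k false (M0 psi) + proj k true (M1 psi) =
  M0 (proj k false psi) + M1 (proj k true psi).
Proof.
by rewrite inE negb_or => /andP[k0 k1] [_ p0] [_ p1]; rewrite p0 ?p1.
Qed.

End Denotation.

(** * Correctness of the compilation *)

Section Correctness.
Context (R : realType) (G : gate_family R) (P : program G).
Context (rho : nat -> int) (n : nat).
Implicit Types (l : seq 'I_n) (S : stmt G (proc P)) (p q : proc P).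
Implicit Types (cs : ctrl (wire P n)) (a : {ffun ancilla P n -> bool}).
Implicit Types (psi : qvect R 'I_n) (C : circuit R (wire P n)).
Implicit Types (M : qvect R 'I_n -> qvect R 'I_n) (B : {set 'I_n}).

Lemma anc_eq p q (m m' : nat) : (m <= n)%N -> (m' <= n)%N ->
  (anc n p m == anc n q m') = (p == q) && (m == m').
Proof.
by move=> mn m'n; rewrite xpair_eqE -(inj_eq val_inj) /= !inordK ?ltnS.
Qed.

(** Code for calls of rank below [r] uses only ancillas of rank below [r]. They start at 0 and, by
    [free_below], do not occur in the enclosing controls. *)
Definition idle_below (r : nat) a : Prop :=
  forall z : ancilla P n, (rank z.1 < r)%N -> a z = false.

Definition free_below (r : nat) cs : Prop :=
  forall z : ancilla P n, (rank z.1 < r)%N -> cs (inr z) = None.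

Definition preserves_inactive (r : nat) cs C : Prop :=
  forall a psi, idle_below r a -> supported (predC (act cs a)) psi ->
    run C (embed psi a) = embed psi a.

(** These two cases suffice: every state over [a] is the sum of an active and an inactive part, and
    [run] is additive. *)
Definition implements (r : nat) cs C M : Prop :=
  preserves_inactive r cs C /\
  forall a psi, idle_below r a -> supported (act cs a) psi ->
    run C (embed psi a) = embed (M psi) a.

Lemma idle_belowW r r' a : (r' <= r)%N -> idle_below r a -> idle_below r' a.
Proof. by move=> rr ia z zr; apply/ia/(leq_trans zr). Qed.

Lemma free_belowW r r' cs : (r' <= r)%N -> free_below r cs -> free_below r' cs.
Proof. by move=> rr ia z zr; apply/ia/(leq_trans zr). Qed.

Lemma implementsW r r' cs C M :
  (r' <= r)%N -> implements r' cs C M -> implements r cs C M.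
Proof.
by move=> rr [idl impl]; split=> a psi /(idle_belowW rr) ia; [apply: idl|apply: impl].
Qed.

Lemma free_below_ctrl r cs k b : free_below r cs -> free_below r (ctrl_set cs (inl k) b).
Proof. by move=> fr z /fr csz; rewrite updE. Qed.

Lemma free_on_ctrl cs k b B :
  k \notin B -> free_on cs B -> free_on (ctrl_set cs (inl k) b) B.
Proof.
by move=> kB fr j jB; rewrite updE; case: eqP => [[jk]|_]; [rewrite -jk jB in kB|apply: fr].
Qed.

Lemma free_onU cs B1 B2 : free_on cs (B1 :|: B2) -> free_on cs B1 /\ free_on cs B2.
Proof. by move=> fr; split=> k kB; apply: fr; rewrite inE kB ?orbT. Qed.

Lemma preserves_inactive_cat r cs C1 C2 :
  preserves_inactive r cs C1 -> preserves_inactive r cs C2 ->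
  preserves_inactive r cs (C1 ++ C2).
Proof. by move=> h1 h2 a psi ia sup; rewrite run_cat h1 ?h2. Qed.

Lemma preserves_inactive_ctrl r cs k b C : cs (inl k) = None ->
  preserves_inactive r (ctrl_set cs (inl k) b) C -> preserves_inactive r cs C.
Proof.
by move=> csk h a psi ia sup; apply: h => //; apply: supported_inact_ctrl_l.
Qed.

Definition call_compiler := ctrl (wire P n) -> seq 'I_n -> proc P ->
  option (circuit R (wire P n)).
Implicit Types ccall : call_compiler.

Definition call_compiler_ok (r : nat) ccall : Prop :=
  forall p cs l M B, (rank p < r)%N -> l <> [::] -> (size l <= n)%N ->
    denotes rho l (body P p) M B -> free_on cs B -> free_below r cs ->
    exists2 C, ccall cs l p = Some C & implements r cs C M.

(** By induction on [S]. In a sequence the first operator keeps the state active; in a quantum case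
    the new control is on a qubit that neither branch targets. *)
Lemma compile_stmt_ok r ccall S cs l M B :
  call_compiler_ok r ccall ->
  all_calls (fun p _ => (rank p < r)%N) S -> denotes rho l S M B ->
  (size l <= n)%N -> free_on cs B -> free_below r cs ->
  exists2 C, compile_stmt rho ccall S cs l = Some C & implements r cs C M.
Proof.
move=> ccallP; elim: S cs M B => [|k u f j|S1 IH1 S2 IH2|b S1 IH1 S2 IH2
    |k S0 IH0 S1 IH1|p s] cs M B /= callsS /denotes_inv + sl.
- by case=> -> _ _ _; exists [::].
- case=> v [-> -> ->] fB fr; have csv := fB v (set11 v); eexists; first by [].
  by split=> a psi ia sup /=; [apply: run_gate_inactive|apply: run_gate_qubit].
- case: callsS => c1 c2 [M1 [M2 [B1 [B2 [d1 d2 -> ->]]]]] /free_onU[f1 f2] fr.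
  have [C1 -> [i1 e1]] := IH1 _ _ _ c1 d1 sl f1 fr.
  have [C2 -> [i2 e2]] := IH2 _ _ _ c2 d2 sl f2 fr.
  exists (C1 ++ C2) => //; split; first exact: preserves_inactive_cat.
  move=> a psi ia sup; rewrite run_cat e1 ?e2 //.
  exact: acts_within_supported (denotes_within d1) f1 sup.
- by case: callsS => c1 c2; case: ifP => _ d fB fr; [apply: IH1 d _ _ _|apply: IH2 d _ _ _].
- case: callsS => c0 c1 [v [M0 [M1 [B0 [B1 [-> vB [d0 d1] -> ->]]]]]] fB fr /=.
  have [/(_ v (set11 v)) csv /free_onU[f0 f1]] := free_onU fB.
  have := vB; rewrite inE negb_or => /andP[v0 v1].
  have [C0 -> [i0 e0]] := IH0 _ _ _ c0 d0 sl (free_on_ctrl false v0 f0)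
    (free_below_ctrl v false fr).
  have [C1 -> [i1 e1]] := IH1 _ _ _ c1 d1 sl (free_on_ctrl true v1 f1)
    (free_below_ctrl v true fr).
  exists (C0 ++ C1) => //; split.
    by apply: preserves_inactive_cat; apply: preserves_inactive_ctrl; eassumption.
  have [w0 w1] := (denotes_within d0, denotes_within d1).
  move=> a psi ia sup; rewrite (qcase_within psi vB w0 w1).
  (* Each branch is inactive on the part of the state where the other acts. *)
  rewrite [in LHS](proj_split v psi) !embedD runD !run_cat; congr (_ + _).
    have s0 := supported_act_proj (b := false) csv sup; rewrite e0 // i1 //.
    apply: (supported_inact_ctrl csv) (acts_within_supported w0 _ s0) => //.
    exact: free_on_ctrl.
  have s1 := supported_act_proj (b := true) csv sup; rewrite i0 ?e1 //.
  exact: (supported_inact_ctrl csv) s1.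
- case=> [[-> -> _] _ _|[l0 d] fB fr]; first by exists [::].
  case: nilP => [//|_]; apply: ccallP d _ _ => //.
  exact: leq_trans (size_seval _ _ _) sl.
Qed.
(** * Anchoring and merging *)

Section Anchoring.
Context (p0 : proc P) (s0 : sexp) (ccall : call_compiler).
Context (s0_removes : removes_qubit s0).
Context (ccallP : call_compiler_ok (rank p0) ccall).

Definition anchorable_call p (s : sexp) : Prop :=
  if call_sim p0 p then s = s0 else (rank p < rank p0)%N.

Context (bodyP : forall p, call_sim p0 p ->
  all_calls anchorable_call (body P p) /\ (width p0 (body P p) <= 1)%N).

Definition next l := seval rho l s0.

Lemma size_next l : l <> [::] -> (size (next l) < size l)%N.
Proof. exact: size_seval_removes. Qed.

Definition scheduled_ctrl l p : ctrl (wire P n) :=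
  ctrl_set (no_ctrl P n) (inr (anc n p (size l))) true.

Definition scheduled l p : ctrl (wire P n) * seq 'I_n * stmt G (proc P) :=
  (scheduled_ctrl l p, l, body P p).

(* [created F] may contain ancillas of earlier levels as well, that is, of larger
   input sizes, whence the last condition. *)
Definition frame_ok l (F : frame P n) (ps : seq (proc P)) : Prop :=
  [/\ merged F = [seq scheduled l p | p <- ps], uniq ps,
      forall p, p \in ps -> [/\ call_sim p0 p, l <> [::]
        & exists M B, denotes rho l (body P p) M B],
      forall p, call_sim p0 p -> (anc n p (size l) \in created F) = (p \in ps)
    & forall p m, call_sim p0 p -> (m < size l)%N -> anc n p m \notin created F].

(** The condition [free_on cs B] makes [M] preserve the active part, so that code idle on that part
    can still be put around [C]. *)
Definition hole_ok cs a l (ps : seq (proc P)) C : Prop :=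
  forall psi, supported (act cs a) psi ->
    run C (embed psi a) = embed psi a /\
    forall p M B, p \in ps -> denotes rho l (body P p) M B -> free_on cs B ->
      run C (embed psi (upd a (anc n p (size l)) true)) =
      embed (M psi) (upd a (anc n p (size l)) true).

Lemma hole_ok_sub cs a l ps ps' C :
  {subset ps <= ps'} -> hole_ok cs a l ps' C -> hole_ok cs a l ps C.
Proof.
by move=> sub hole psi /hole[h1 h2]; split=> // p M B /sub; apply: h2.
Qed.

Lemma free_on_ctrl_sub cs k b B : free_on (ctrl_set cs (inl k) b) B -> free_on cs B.
Proof. by move=> fB j /fB; rewrite updE; case: eqP. Qed.

Lemma hole_ok_ctrl cs k b a l ps C : cs (inl k) = None ->
  hole_ok cs a l ps C -> hole_ok (ctrl_set cs (inl k) b) a l ps C.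
Proof.
move=> csk hole psi /(supported_ctrl_l csk) /hole[h1 h2].
by split=> // p M B pps d /free_on_ctrl_sub; apply: h2.
Qed.

(** Nests the frame of one statement in the hole of another: code idle both on [a] and after setting
    one ancilla of [ps] does not disturb what the hole does. *)
Lemma hole_ok_wrap cs a l (ps : seq (proc P)) L C C' :
  (forall p, p \in ps -> cs (inr (anc n p (size l))) = None) ->
  hole_ok cs a l ps C ->
  (forall a', a' = a \/ (exists2 p, p \in ps & a' = upd a (anc n p (size l)) true) ->
     forall psi, supported (act cs a') psi ->
     run L (embed psi a') = embed psi a' /\ run C' (embed psi a') = embed psi a') ->
  hole_ok cs a l ps (L ++ C ++ C').
Proof.
move=> fa hole idl psi sup; have [h1 h2] := hole psi sup.
have [i1 i2] := idl a (or_introl erefl) psi sup.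
split=> [|p M B pps d fB]; first by rewrite !run_cat i1 h1.
have sup' := supported_act_upd (b := true) (fa p pps) sup.
have aa' : exists2 q, q \in ps & upd a (anc n p (size l)) true = upd a (anc n q (size l)) true.
  by exists p.
rewrite !run_cat (idl _ (or_intror aa') psi sup').1 (h2 _ _ _ pps d fB).
apply: (idl _ (or_intror aa') (M psi) _).2.
exact: acts_within_supported (denotes_within d) fB sup'.
Qed.

Lemma idle_upd r a q m b : call_sim p0 q -> (r <= rank p0)%N -> idle_below r a ->
  idle_below r (upd a (anc n q m) b).
Proof.
move=> q0 rp ia z zr; rewrite updE; case: eqP => [zE|_]; last exact: ia.
by move: zr; rewrite zE /= -(rank_sim q0) ltnNge rp.
Qed.

(** Width 0 excludes calls within the class of [p0], and the remaining calls go down in rank. *)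
Lemma width0_calls S : all_calls anchorable_call S -> width p0 S == 0%N ->
  all_calls (fun p _ => (rank p < rank p0)%N) S.
Proof.
elim: S => //= [S1 IH1 S2 IH2|_ S1 IH1 S2 IH2|_ S1 IH1 S2 IH2|p s].
- by case=> c1 c2; rewrite addn_eq0 => /andP[/(IH1 c1) ? /(IH2 c2) ?].
- by case=> c1 c2; rewrite -leqn0 geq_max !leqn0 => /andP[/(IH1 c1) ? /(IH2 c2) ?].
- by case=> c1 c2; rewrite -leqn0 geq_max !leqn0 => /andP[/(IH1 c1) ? /(IH2 c2) ?].
- by rewrite /anchorable_call; case: call_sim.
Qed.

Lemma anchor_width0 S cs l F : width p0 S == 0%N ->
  anchor rho ccall p0 S cs l F =
  obind (fun C => Some (emit C [::] F)) (compile_stmt rho ccall S cs l).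
Proof. by case: S => [|????|??|???|???|??] //= ->. Qed.

(* [F'] is [F] with [L] and [C'] added around the hole; filled with a circuit
   for the scheduled bodies, they implement the statement denoting [M]. *)
Definition extends l cs M (F : frame P n) (ps : seq (proc P)) F' ps' L C' : Prop :=
  [/\ cL F' = cL F ++ L, cR F' = C' ++ cR F, frame_ok (next l) F' ps'
    & {subset ps <= ps'}] /\
  [/\ preserves_inactive (rank p0) cs L, preserves_inactive (rank p0) cs C'
    & forall C a psi, idle_below (rank p0) a ->
        (forall p, call_sim p0 p -> a (anc n p (size (next l))) = false) ->
        hole_ok cs a (next l) ps' C -> supported (act cs a) psi ->
        run (L ++ C ++ C') (embed psi a) = embed (M psi) a].

Lemma frame_ok_anchor_call p cs l F ps M B :
  call_sim p0 p -> l <> [::] -> (size l <= n)%N -> denotes rho l (body P p) M B ->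
  frame_ok l F ps ->
  exists2 ps', frame_ok l (anchor_call p cs l F) ps' & p \in ps' /\ {subset ps <= ps'}.
Proof.
move=> p0p l0 sl d Fok; have [mE u inv crE new] := Fok.
rewrite /anchor_call crE //; case: ifPn => pps; first by apply: (ex_intro2 _ _ ps Fok (conj pps _)).
exists (rcons ps p); last first.
  by split=> [|q]; rewrite mem_rcons inE ?eqxx // => ->; rewrite orbT.
split=> /=.
- by rewrite mE map_rcons.
- by rewrite rcons_uniq pps.
- move=> q; rewrite mem_rcons inE => /orP[/eqP->|/inv //].
  by split=> //; exists M, B.
- by move=> q p0q; rewrite mem_rcons !inE anc_eq // eqxx andbT crE.
- move=> q m p0q lt; rewrite !inE negb_or new // andbT anc_eq //.
    by rewrite (ltn_eqF lt) andbF.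
  exact: leq_trans (ltnW lt) sl.
Qed.

Lemma cL_anchor_call p cs l F :
  cL (anchor_call p cs l F) = cL F ++ [:: cnot R cs (inr (anc n p (size l)))].
Proof. by rewrite /anchor_call; case: ifP. Qed.

Lemma cR_anchor_call p cs l F :
  cR (anchor_call p cs l F) = [:: cnot R cs (inr (anc n p (size l)))] ++ cR F.
Proof. by rewrite /anchor_call; case: ifP. Qed.

(* The ancilla is set on the active part, the body acts on it without leaving
   that part, hence the second [cnot] clears the ancilla. *)
Lemma run_anchored p cs a l C M B psi :
  cs (inr (anc n p (size l))) = None -> a (anc n p (size l)) = false ->
  acts_within B M -> free_on cs B -> supported (act cs a) psi ->
  run C (embed psi (upd a (anc n p (size l)) true)) =
    embed (M psi) (upd a (anc n p (size l)) true) ->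
  run ([:: cnot R cs (inr (anc n p (size l)))] ++ C ++
       [:: cnot R cs (inr (anc n p (size l)))]) (embed psi a) = embed (M psi) a.
Proof.
move=> csa a0 MB fB sup hole; rewrite !run_cat /= run_cnot // a0 hole.
have supM := acts_within_supported MB fB sup.
rewrite run_cnot //; last exact: supported_act_upd.
by rewrite upd_same upd_upd /= -[in upd _ _ _]a0 upd_id.
Qed.

Lemma anchor_ok_width0 S cs l M B F ps :
  width p0 S == 0%N -> all_calls anchorable_call S ->
  denotes rho l S M B -> (size l <= n)%N ->
  free_on cs B -> free_below (rank p0) cs -> frame_ok (next l) F ps ->
  exists F' ps' L C', anchor rho ccall p0 S cs l F = Some F' /\
    extends l cs M F ps F' ps' L C'.
Proof.
move=> w0 /width0_calls/(_ w0) callsS d sl fB fr Fok.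
have [C cE [idl impl]] := compile_stmt_ok ccallP callsS d sl fB fr.
rewrite anchor_width0 // cE; exists (emit C [::] F), ps, C, [::].
split=> //; split; first by split.
split=> // H a psi ia _ hole sup.
have supM := acts_within_supported (denotes_within d) fB sup.
by rewrite cats0 run_cat impl // (hole _ supM).1.
Qed.

(** In a sequence, the side without recursive calls goes to the left or to the right of the hole. In
    a quantum case, the second branch is nested in the hole of the first, as
    [L0 ++ (L1 ++ C ++ C1) ++ C0]. *)
Lemma anchor_ok S cs l M B F ps :
  all_calls anchorable_call S -> (width p0 S <= 1)%N ->
  denotes rho l S M B -> (size l <= n)%N ->
  free_on cs B -> free_below (rank p0) cs ->
  (forall p, call_sim p0 p -> cs (inr (anc n p (size (next l)))) = None) ->
  frame_ok (next l) F ps ->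
  exists F' ps' L C', anchor rho ccall p0 S cs l F = Some F' /\
    extends l cs M F ps F' ps' L C'.
Proof.
move=> + + + sl.
elim: S cs M B F ps => [|k u f j|S1 IH1 S2 IH2|b S1 IH1 S2 IH2|k S0 IH0 S1 IH1|p s]
  cs M B F ps callsS wS d fB fr fa Fok;
  (match goal with |- context [anchor _ _ _ ?S _ _ _] =>
     have [w0|w1] := boolP (width p0 S == 0%N) end;
   first exact: anchor_ok_width0 w0 callsS d sl fB fr Fok) => //=;
   try (by case/negP: w1); move: (w1) => /= /negPf ->.
- case: callsS => c1 c2; move: wS w1 fB => /= wS w1.
  case/denotes_inv: d => M1 [M2 [B1 [B2 [d1 d2 -> ->]]]] /free_onU[f1 f2].
  have [v1|v1] := boolP (width p0 S1 == 0%N).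
    have [C1 -> [i1 e1]] := compile_stmt_ok ccallP (width0_calls c1 v1) d1 sl f1 fr.
    have w2 : (width p0 S2 <= 1)%N by move: wS; rewrite (eqP v1).
    have [F' [ps' [L [C' [/= -> [[lE rE Fok' sub] [iL iC' eF]]]]]]] :=
      IH2 cs M2 B2 (emit C1 [::] F) ps c2 w2 d2 f2 fr fa Fok.
    exists F', ps', (C1 ++ L), C'; split=> //; split; first by split; rewrite // lE -catA.
    split=> //; first exact: preserves_inactive_cat.
    move=> C a psi ia a0 hole sup; rewrite -catA run_cat e1 // eF //.
    exact: acts_within_supported (denotes_within d1) f1 sup.
  (* The recursive call is in [S1], so the code of [S2] can move to the right. *)
  have v2 : width p0 S2 == 0%N by move: v1 wS; lia.
  have [C2 -> [i2 e2]] := compile_stmt_ok ccallP (width0_calls c2 v2) d2 sl f2 fr.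
  have v1' : (width p0 S1 <= 1)%N by move: wS; lia.
  have [F' [ps' [L [C' [/= -> [[lE rE Fok' sub] [iL iC' eF]]]]]]] :=
    IH1 cs M1 B1 (emit [::] C2 F) ps c1 v1' d1 f1 fr fa Fok.
  exists F', ps', L, (C' ++ C2); split=> //; split.
    by split; rewrite // ?lE ?rE /= ?cats0 -?catA.
  split=> //; first exact: preserves_inactive_cat.
  move=> C a psi ia a0 hole sup; rewrite catA catA run_cat -catA eF // e2 //.
  exact: acts_within_supported (denotes_within d1) f1 sup.
- case: callsS => c1 c2; move: wS; rewrite /= geq_max => /andP[v1 v2].
  case: ifP (denotes_inv d) => _ d'.
    exact: IH1 c1 v1 d' fB fr fa Fok.
  exact: IH2 c2 v2 d' fB fr fa Fok.
- case: callsS => c0 c1; move: wS; rewrite /= geq_max => /andP[u0 u1].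
  case/denotes_inv: d fB => v [M0 [M1 [B0 [B1 [-> vB [d0 d1] -> ->]]]]] fB /=.
  have [/(_ v (set11 v)) csv /free_onU[f0 f1]] := free_onU fB.
  have := vB; rewrite inE negb_or => /andP[v0 v1].
  have fa' b p : call_sim p0 p ->
    ctrl_set cs (inl v) b (inr (anc n p (size (next l)))) = None.
    by move=> /fa csa; rewrite updE.
  have g0 := free_on_ctrl false v0 f0; have g1 := free_on_ctrl true v1 f1.
  have [F1 [ps1 [L0 [C0 [-> [[lE0 rE0 Fok1 sub0] [iL0 iC0 e0]]]]]]] :=
    IH0 _ _ _ F ps c0 u0 d0 g0 (free_below_ctrl v false fr) (fa' false) Fok.
  have [F2 [ps2 [L1 [C1 [/= -> [[lE1 rE1 Fok2 sub1] [iL1 iC1 e1]]]]]]] :=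
    IH1 _ _ _ F1 ps1 c1 u1 d1 g1 (free_below_ctrl v true fr) (fa' true) Fok1.
  exists F2, ps2, (L0 ++ L1), (C1 ++ C0); split=> //; split.
    split=> //; first by rewrite lE1 lE0 catA.
      by rewrite rE1 rE0 catA.
    by move=> q /sub0 /sub1.
  split.
  + by apply: preserves_inactive_cat; apply: preserves_inactive_ctrl; eassumption.
  + by apply: preserves_inactive_cat; apply: preserves_inactive_ctrl; eassumption.
  have [w0' w1'] := (denotes_within d0, denotes_within d1).
  move=> C a psi ia a0 hole sup; rewrite (qcase_within psi vB w0' w1').
  have -> : (L0 ++ L1) ++ C ++ C1 ++ C0 = L0 ++ (L1 ++ C ++ C1) ++ C0 by rewrite -!catA.
  rewrite [in LHS](proj_split v psi) !embedD runD; congr (_ + _).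
    (* Where qubit [v] is 0, the code [L1], [C1] of the other branch is idle and is absorbed into
       the hole. *)
    apply: e0 => //; last exact: supported_act_proj.
    have sim1 p : p \in ps1 -> call_sim p0 p by case: Fok1 => _ _ inv _ _ /inv[].
    apply: hole_ok_wrap.
    + by move=> p /sim1; apply: fa'.
    + by apply: hole_ok_sub sub1 _; apply: hole_ok_ctrl.
    move=> a' aa' phi sup0.
    have n1 := supported_inact_ctrl (c := true) csv (isT : false != true) sup0.
    have ia' : idle_below (rank p0) a'.
      by case: aa' => [->//|[p /sim1 p0p ->]]; apply: idle_upd.
    by split; [apply: iL1|apply: iC1].
  (* Where qubit [v] is 1, [L0] and [C0] are idle and only the inner frame acts. *)
  have s1 := supported_act_proj (b := true) csv sup.
  have n0 := supported_inact_ctrl (c := false) csv (isT : true != false) s1.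
  rewrite run_cat iL0 // run_cat e1 //; last exact: hole_ok_ctrl.
  by apply: iC0 => //; apply: (supported_inact_ctrl csv _ (acts_within_supported w1' g1 s1)).
(* The width is not 0, so the call stays in the class of [p0] and its argument is [s0]. *)
- move: callsS w1; rewrite /anchorable_call /=; case: ifP => // p0p sE _; subst s.
  case/denotes_inv: d fB => [[l0 -> ->]|[l0 d]] fB.
    rewrite l0 /=; exists F, ps, [::], [::]; split=> //; split.
      by split; rewrite ?cats0.
    by split=> // C a psi _ _ hole sup; rewrite cats0 (hole psi sup).1.
  case: nilP => [//|_].
  have sl' := leq_trans (size_seval rho l s0) sl.
  have [ps' Fok' [pps sub]] := frame_ok_anchor_call cs p0p l0 sl' d Fok.
  eexists _, ps', _, _; split; first by [].
  split; first by split; [exact: cL_anchor_call|exact: cR_anchor_call| |].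
  split.
  + by move=> a psi ia sup /=; apply: run_gate_inactive => //; apply: fa.
  + by move=> a psi ia sup /=; apply: run_gate_inactive => //; apply: fa.
  move=> C a psi ia a0 hole sup; apply: (run_anchored _ _ (denotes_within d) fB sup).
  + exact: fa.
  + exact: a0.
  exact: ((hole psi sup).2 _ _ _ pps d fB).
Qed.

(** * Bodies scheduled at one level, and the recursion over the levels *)

Lemma act_scheduled l p a x : act (scheduled_ctrl l p) a x = a (anc n p (size l)).
Proof.
rewrite /act active_upd_some ?ffunE // eqb_id andb_idl // => _.
by apply/forallP=> w; rewrite ffunE.
Qed.

(** The form of [hole_ok] for code controlled by ancillas alone: it speaks of every state of the
    qubits. *)
Definition hole_total a l (ps : seq (proc P)) C : Prop :=
  forall psi, run C (embed psi a) = embed psi a /\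
    forall p M B, p \in ps -> denotes rho l (body P p) M B ->
      run C (embed psi (upd a (anc n p (size l)) true)) =
      embed (M psi) (upd a (anc n p (size l)) true).

Lemma hole_total_ok cs a l ps C : hole_total a l ps C -> hole_ok cs a l ps C.
Proof.
by move=> hole psi _; have [h1 h2] := hole psi; split=> // p M B pps d _; apply: h2 d.
Qed.

Definition schedulable l (qs : seq (proc P)) : Prop :=
  forall q, q \in qs -> call_sim p0 q /\ exists M B, denotes rho l (body P q) M B.

(** Deeper levels have shorter inputs, so with [m] the size of the current level this covers that
    level and all later ones. *)
Definition clear_upto (m : nat) a : Prop :=
  forall p k, call_sim p0 p -> (k <= m)%N -> a (anc n p k) = false.

Lemma clear_upd m k a p b : call_sim p0 p -> (m < k <= n)%N -> clear_upto m a ->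
  clear_upto m (upd a (anc n p k) b).
Proof.
move=> p0p /andP[mk kn] clear q j p0q jm; rewrite updE anc_eq //.
  by rewrite (ltn_eqF (leq_ltn_trans jm mk)) andbF clear.
exact: leq_trans jm (leq_trans (ltnW mk) kn).
Qed.

(** By induction on the bodies of the level, each anchored inside the hole of the previous ones.
    When the ancilla of [q] is the only one set among theirs, the code of every other body is
    idle. *)
Lemma anchor_level_ok l (qs : seq (proc P)) F ps :
  l <> [::] -> (size l <= n)%N -> uniq qs -> schedulable l qs ->
  frame_ok (next l) F ps ->
  exists F' ps' L C',
    [/\ foldl (fun oF c => obind (fun F => anchor rho ccall p0 c.2 c.1.1 c.1.2 F) oF)
          (Some F) [seq scheduled l q | q <- qs] = Some F',
        cL F' = cL F ++ L, cR F' = C' ++ cR F & frame_ok (next l) F' ps'] /\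
    [/\ {subset ps <= ps'},
      forall a psi, idle_below (rank p0) a ->
        (forall q, q \in qs -> a (anc n q (size l)) = false) ->
        run L (embed psi a) = embed psi a /\ run C' (embed psi a) = embed psi a
    & forall q M B C a psi, q \in qs -> denotes rho l (body P q) M B ->
        idle_below (rank p0) a -> clear_upto (size l) a ->
        hole_total (upd a (anc n q (size l)) true) (next l) ps' C ->
        run (L ++ C ++ C') (embed psi (upd a (anc n q (size l)) true)) =
        embed (M psi) (upd a (anc n q (size l)) true)].
Proof.
move=> l0 sl; elim: qs F ps => [|q qs IH] F ps.
  move=> _ _ Fok; exists F, ps, [::], [::]; split; first by split; rewrite ?cats0.
  by split.
rewrite [uniq _]/= => /andP[qqs uqs] sch Fok.
have [p0q [M [B d]]] := sch q (mem_head _ _).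
have nl := size_next l0; have nln := leq_trans (ltnW nl) sl.
have fB : free_on (scheduled_ctrl l q) B by move=> k _; rewrite updE ffunE.
have fr : free_below (rank p0) (scheduled_ctrl l q).
  move=> z zr; rewrite updE; case: eqP => [[zE]|_]; last by rewrite ffunE.
  by move: zr; rewrite zE (rank_sim p0q) /= ltnn.
have fa p : call_sim p0 p -> scheduled_ctrl l q (inr (anc n p (size (next l)))) = None.
  move=> p0p; rewrite updE (inj_eq (@inr_inj _ _)) anc_eq // (ltn_eqF nl) andbF.
  by rewrite ffunE.
have [cq wq] := bodyP p0q.
have [F1 [ps1 [L1 [C1 [aE [[lE1 rE1 Fok1 sub1] [iL1 iC1 e1]]]]]]] :=
  anchor_ok cq wq d sl fB fr fa Fok.
have sch' : schedulable l qs by move=> p pqs; apply: sch; rewrite inE pqs orbT.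
have [F2 [ps2 [L2 [C2 [[foldE lE2 rE2 Fok2] [sub2 idle2 e2]]]]]] :=
  IH F1 ps1 uqs sch' Fok1.
exists F2, ps2, (L1 ++ L2), (C2 ++ C1); split.
  split=> //; last by rewrite rE2 rE1 catA.
    by rewrite /= aE.
  by rewrite lE2 lE1 catA.
have i1 a psi : idle_below (rank p0) a -> a (anc n q (size l)) = false ->
    run L1 (embed psi a) = embed psi a /\ run C1 (embed psi a) = embed psi a.
  move=> ia aq; have inact : supported (predC (act (scheduled_ctrl l q) a)) psi.
    by move=> x; rewrite /= act_scheduled aq.
  by split; [apply: iL1|apply: iC1].
split.
- by move=> p /sub1 /sub2.
- move=> a psi ia a0; rewrite !run_cat.
  have [hL1 hC1] := i1 a psi ia (a0 q (mem_head _ _)).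
  have a0' p : p \in qs -> a (anc n p (size l)) = false.
    by move=> pqs; apply: a0; rewrite inE pqs orbT.
  by have [hL2 hC2] := idle2 a psi ia a0'; rewrite hL1 hL2 hC2 hC1.
(* If [p] comes later in the list, the code of the first body is idle; if [p] is the first body, the
   code of the later ones is absorbed into its hole. *)
move=> p M' B' C a psi; rewrite inE; have [-> _ d'|pq /= pqs] := eqVneq p q; last first.
  move=> d' ia clear hole; have [p0p _] := sch' p pqs.
  have ia' := idle_upd (size l) true p0p (leqnn _) ia.
  have aq : upd a (anc n p (size l)) true (anc n q (size l)) = false.
    by rewrite upd_other ?clear // anc_eq // eq_sym (negPf pq).
  have -> : (L1 ++ L2) ++ C ++ C2 ++ C1 = L1 ++ (L2 ++ C ++ C2) ++ C1 by rewrite -!catA.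
  by rewrite run_cat (i1 _ _ ia' aq).1 run_cat (e2 _ _ _ _ _ _ pqs d') // (i1 _ _ ia' aq).2.
have [-> _] := denotes_det d' d.
move=> ia clear hole; have ia' := idle_upd (size l) true p0q (leqnn _) ia.
have -> : (L1 ++ L2) ++ C ++ C2 ++ C1 = L1 ++ (L2 ++ C ++ C2) ++ C1 by rewrite -!catA.
have clear' p' : call_sim p0 p' ->
    upd a (anc n q (size l)) true (anc n p' (size (next l))) = false.
  move=> p0p'; rewrite upd_other; first by apply: clear => //; apply: ltnW.
  by rewrite anc_eq // (ltn_eqF nl) andbF.
apply: e1 => //; last by move=> x; rewrite act_scheduled upd_same.
have sim1 p' : p' \in ps1 -> call_sim p0 p' by case: Fok1 => _ _ inv _ _ /inv[].
apply: hole_ok_wrap.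
- by move=> p' /sim1; apply: fa.
- by apply: (hole_ok_sub sub2); apply: hole_total_ok.
move=> a' aa' phi _.
have ia'' : idle_below (rank p0) a'.
  by case: aa' => [->//|[p' /sim1 p0p' ->]]; apply: idle_upd.
apply: idle2 => // p' p'qs; have [p0p' _] := sch' p' p'qs.
have old : upd a (anc n q (size l)) true (anc n p' (size l)) = false.
  rewrite upd_other ?clear // anc_eq // eqxx andbT.
  by apply: contraNneq qqs => <-.
(* An ancilla set for the hole belongs to the next level, so its size differs from that of [l]. *)
case: aa' => [->//|[r _ ->]]; rewrite upd_other // anc_eq //.
by rewrite (gtn_eqF nl) andbF.
Qed.

(** By induction on [d]: the hole of each level is filled with the code of the next one, whose input
    is strictly shorter. *)
Lemma optimize_ok d l (qs : seq (proc P)) (known : {set ancilla P n}) :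
  (size l <= n)%N -> (qs <> [::] -> l <> [::] /\ (size l <= d)%N) ->
  uniq qs -> schedulable l qs ->
  (forall p m, call_sim p0 p -> (m < size l)%N -> anc n p m \notin known) ->
  exists2 C, optimize rho ccall p0 d [seq scheduled l q | q <- qs] known = Some C &
    forall a, idle_below (rank p0) a -> clear_upto (size l) a -> hole_total a l qs C.
Proof.
elim: d l qs known => [|d IH] l [|q0 qs0] known sl dl uqs sch new;
  try by exists [::].
  (* With no depth left and a body to compile, [l] would have to be both empty and nonempty. *)
  by have [] // := dl _; case: l {sl dl sch new}.
have [//|l0 sld] := dl.
have nl := size_next l0; have nln := leq_trans (ltnW nl) sl.
have F0ok : frame_ok (next l) (Frame [::] [::] [::] known) [::].
  by split=> //= p => [p0p|m p0p lt]; [apply/negbTE|]; apply: new => //; apply: ltn_trans nl.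
have [F' [ps' [L [C' [[foldE lE rE Fok] [_ idle eL]]]]]] :=
  anchor_level_ok l0 sl uqs sch F0ok.
have [mE ups inv _ new'] := Fok.
have dl' : ps' <> [::] -> next l <> [::] /\ (size (next l) <= d)%N.
  case: ps' inv {Fok mE ups eL} => [//|p ps'] inv _.
  have [_ nl0 _] := inv p (mem_head _ _).
  by split=> //; rewrite -ltnS (leq_trans nl).
have sch' : schedulable (next l) ps' by move=> p /inv[].
have [C CE hole] := IH (next l) ps' (created F') nln dl' ups sch' new'.
exists (L ++ C ++ C'); first by move: foldE => /= ->; rewrite /= mE CE lE rE /= cats0.
move=> a ia clear.
have clear' : clear_upto (size (next l)) a.
  by move=> p k p0p kl; apply: clear => //; apply: leq_trans kl (ltnW nl).
move=> psi; split=> [|p M B pqs d'].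
  have a0 q : q \in q0 :: qs0 -> a (anc n q (size l)) = false.
    by move=> /sch[p0q _]; apply: clear.
  have [hL hC'] := idle a psi ia a0.
  by rewrite !run_cat hL (hole a ia clear' psi).1.
apply: (eL _ _ _ _ _ _ pqs d' ia clear); have [p0p _] := sch p pqs; apply: hole.
  exact: idle_upd.
by apply: clear_upd => //; rewrite nl.
Qed.

(** The bound is [(rank p0).+1] because the call uses ancillas of its own class, all of rank
    [rank p0]; idleness below this bound clears them for every size. *)
Lemma recursive_call_ok d p cs l M B :
  call_sim p0 p -> l <> [::] -> (size l <= n)%N -> (size l <= d)%N ->
  denotes rho l (body P p) M B ->
  free_on cs B -> free_below (rank p0).+1 cs ->
  let F := anchor_call p cs l (Frame [::] [::] [::] set0) in
  exists2 C, optimize rho ccall p0 d (merged F) (created F) = Some C &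
    implements (rank p0).+1 cs (cL F ++ C ++ cR F) M.
Proof.
move=> p0p l0 sl sd den fB fr F.
have -> : merged F = [seq scheduled l q | q <- [:: p]] by rewrite /F /anchor_call inE.
have sch : schedulable l [:: p] by move=> q; rewrite inE => /eqP->; split=> //; exists M, B.
have new q m : call_sim p0 q -> (m < size l)%N -> anc n q m \notin created F.
  move=> _ ml; rewrite /F /anchor_call inE /= !inE orbF anc_eq //.
    by rewrite (ltn_eqF ml) andbF.
  exact: leq_trans (ltnW ml) sl.
have [C -> hole] := optimize_ok sl (fun _ => conj l0 sd) (isT : uniq [:: p]) sch new.
exists C => //; rewrite /F cL_anchor_call cR_anchor_call /=.
have csa : cs (inr (anc n p (size l))) = None by apply: fr; rewrite /= -(rank_sim p0p).
have clear a : idle_below (rank p0).+1 a -> clear_upto (size l) a.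
  by move=> ia q k p0q _; apply: ia; rewrite /= -(rank_sim p0q).
split=> a psi ia sup; have ia' := idle_belowW (leqnSn _) ia;
  have hole' := hole a ia' (clear a ia).
- rewrite -[_ :: _]/([:: _] ++ _) !run_cat /= run_gate_inactive // (hole' psi).1.
  by rewrite run_gate_inactive.
- apply: (run_anchored csa _ (denotes_within den) fB sup).
    by apply: ia; rewrite /= -(rank_sim p0p).
  by apply: (hole' psi).2 den; rewrite inE.
Qed.

End Anchoring.

(** * Programs of the class [pbp], and the correctness of their compilation *)

Section Pbp.
Context (P_pbp : pbp P).

Lemma pbp_anchorable : exists2 s0, removes_qubit s0 &
  forall p0 p, call_sim p0 p ->
    all_calls (anchorable_call p0 s0) (body P p) /\ (width p0 (body P p) <= 1)%N.
Proof.
have [wf w [s [_ bodys]]] := P_pbp.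
(* If [s] is [QBar], a recursive call would be on [QBar], against well-foundedness. So there is
   none, and any expression that removes a qubit serves as [s0]. *)
exists (if removes_qubit s then s else SMinus QBar (IConst 0)); first by case: ifP.
move=> p0 p p0p; split; last by rewrite (width_sim _ p0p).
apply: all_calls_sub (all_calls_and (wf p) (bodys p)) => q t pq [rem tE].
rewrite /anchorable_call (call_sim_eq p0p) (rank_sim p0p).
case: ifPn => [pq_sim|]; last exact: rank_call.
by case: tE (rem pq_sim) => ->; last move=> ->.
Qed.

(** A procedure reaches itself, so ranks are at least 1 and depth [d] suffices up to rank [d]
    included, whence the bound [d.+1]. *)
Lemma compile_call_ok d r :
  (r <= d.+1)%N -> call_compiler_ok r (compile_call (P := P) rho d).
Proof.
elim: d r => [|d IH] r rd p cs l M B pr l0 sl den fB fr.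
  have := leq_trans pr rd; rewrite ltnS leqn0 => /eqP/card0_eq/(_ p).
  by rewrite inE connect0.
have pd : (rank p <= d.+1)%N by rewrite -ltnS (leq_trans pr).
have [s0 s0r bodyP] := pbp_anchorable; rewrite /=; case: ifPn => [p_rec|p_nrec].
  have [C -> impl] := recursive_call_ok s0r (IH _ pd) (bodyP p) p_rec l0 sl (leqnn _) den fB
    (free_belowW pr fr).
  by eexists; [|apply: implementsW pr impl].
(* A call back into the class of [p] would make [p] recursive. *)
have calls_lt : all_calls (fun q _ => (rank q < rank p)%N) (body P p).
  apply: all_calls_sub (all_calls_true (Q := fun _ _ => True) _ _) => // q _ pq _.
  apply: rank_call pq _; apply: contra p_nrec => sim_pq.
  by apply: (call_sim_trans sim_pq); rewrite call_sim_sym.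
have [C -> impl] := compile_stmt_ok (IH _ pd) calls_lt den sl fB (free_belowW (ltnW pr) fr).
by exists C => //; apply: implementsW (ltnW pr) impl.
Qed.

End Pbp.

End Correctness.

Theorem mainTheorem1 (R : realType) (G : gate_family R) (P : program G)
    (rho : nat -> int) (n : nat) (psi psi' : qvect R 'I_n) :
  pbp P -> normalized psi -> program_sem P rho psi psi' ->
  exists2 C, compile P rho n = Some C & circuit_sem C psi psi'.
Proof.
move=> P_pbp _ /exec_denotes[M [B [den _ ->]]].
have calls_le : all_calls (fun p _ => (rank p < #|proc P|.+1)%N) (main P).
  by apply: all_calls_true => p _; rewrite ltnS rank_le_card.
have sz : (size (enum 'I_n) <= n)%N by rewrite size_enum_ord.
have fB : free_on (no_ctrl P n) B by move=> k _; rewrite ffunE.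
have fr : free_below #|proc P|.+1 (no_ctrl P n) by move=> z _; rewrite ffunE.
have [C CE [_ impl]] := compile_stmt_ok
  (compile_call_ok P_pbp (leqnn _)) calls_le den sz fB fr.
(* Without controls every basis state is active, and all the ancillas start at 0. *)
exists C => //; rewrite /circuit_sem !with_ancillas_embed; apply: impl.
  by move=> z _; rewrite ffunE.
by move=> x; rewrite negb_forall => /existsP[w]; rewrite ffunE.
Qed.
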